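(* Let $k \geq 3$. Then for every positive integer $v$, $$\mathrm{ex}(v, C_{2k}, \mathcal{C}_{\mathrm{odd}} \cup \{C_4\}) \leq \frac{1}{2k}\left(\frac{v}{2}\right)_{(k)}.$$
   Context: For a real $x$, $x_{(k)} = x(x-1)\cdots(x-k+1)$. $C_m$ denotes the cycle of length $m$ and $\mathcal{C}_{\mathrm{odd}} = \{C_3, C_5, C_7, \dots\}$ is the set of all odd cycles. $\mathrm{ex}(v, C_{2k}, \mathcal{C}_{\mathrm{odd}} \cup \{C_4\})$ denotes the maximum number of copies of $C_{2k}$ (cycles of length $2k$ as subgraphs) in a graph on $v$ vertices that contains no odd cycle and no $C_4$ as a subgraph.
   Formalization: The right-hand side is replaced by its maximum with 0, since for some small odd v (e.g. k = 3, v = 3) the quantity (v/2)_(k) is negative and the printed inequality fails; where it is nonnegative the bound is the printed one. *)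

(* Defs.v *)
From HB Require Import structures.
From mathcomp Require Import all_boot all_order all_algebra.
From mathcomp Require Import boolp.
Set Implicit Arguments.
Unset Strict Implicit.
Unset Printing Implicit Defensive.

Record sgraph (T : finType) := SGraph {
  edges : {set {set T}};
  _ : [forall e in edges, #|e| == 2]
}.
HB.instance Definition _ (T : finType) := [isSub for @edges T].
HB.instance Definition _ (T : finType) := [Finite of sgraph T by <:].

Definition graph := {n : nat & sgraph 'I_n}.

Definition cycle_edges m : {set {set 'I_m}} :=
  [set [set i; ordS i] | i : 'I_m & i != ordS i].

Lemma cycle_edges_simple m : [forall e in cycle_edges m, #|e| == 2].
Proof.
by apply/forall_inP => e /imsetP[i]; rewrite inE => ni ->; rewrite cards2 ni.
Qed.

(* The cycle 0 - 1 - ... - (m-1) - 0; it is the cycle of length m only for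
   m >= 3 (for m = 2 it degenerates to a single edge). *)
Definition C_ m : graph := Tagged (fun n => sgraph 'I_n)
  (SGraph (cycle_edges_simple m)).

(* The copies of H in G, i.e. the subgraphs (V, E) of G isomorphic to H. *)
Definition copies (T : finType) (H : graph) (G : sgraph T) :
    {set {set T} * {set {set T}}} :=
  [set (f @: setT, [set f @: (e : {set 'I_(tag H)}) | e in edges (tagged H)])
  | f : {ffun 'I_(tag H) -> T} &
    injectiveb f &&
    ([set f @: (e : {set 'I_(tag H)}) | e in edges (tagged H)]
       \subset edges G)].

Definition contains (T : finType) (G : sgraph T) (H : graph) : Prop :=
  copies H G != set0.

Definition is_free (T : finType) (F : graph -> Prop) (G : sgraph T) : Prop :=
  forall H, F H -> ~ contains G H.

(* The maximum number of copies of H in an F-free graph on v vertices; every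
   graph on v vertices is isomorphic to one on 'I_v. *)
Definition ex (v : nat) (H : graph) (F : graph -> Prop) : nat :=
  \max_(G : sgraph 'I_v | `[< is_free F G >]) #|copies H G|.

Definition C_odd (H : graph) : Prop :=
  exists m, [/\ 3 <= m, odd m & H = C_ m].

Definition C_odd_C4 (H : graph) : Prop := C_odd H \/ H = C_ 4.

(* Negative for some half-integers x < k - 1, e.g. x = 3 / 2 and k = 3; a count
   bounded by it can therefore only be compared with its maximum with 0. *)
Definition falling (R : pzRingType) (x : R) (k : nat) : R :=
  (\prod_(i < k) (x - i%:R))%R.

(* Main.v *)
Require Import Defs.
From mathcomp Require Import all_boot all_order all_algebra.
From mathcomp Require boolp.
From mathcomp Require Import zify.
Import Order.TTheory GRing.Theory Num.Theory.
Local Open Scope ring_scope.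

Set Implicit Arguments.
Unset Strict Implicit.
Unset Printing Implicit Defensive.

(* A graph without odd cycles is bipartite; let A be the smaller class, so that
   #|A| <= v / 2.  Each 2k-cycle has 2k labellings (k rotations, with or without
   a reflection) that put A at the even positions.  As two vertices have at most
   one common neighbour in a C_4-free graph, such a labelling is determined by
   its k distinct values at the even positions, so there are at most
   #|A|_(k) of them. *)

(** * Cycles and odd closed walks *)

Definition adj (T : finType) (G : sgraph T) : rel T :=
  [rel x y | [set x; y] \in edges G].

Section Adjacency.
Variables (T : finType) (G : sgraph T).

Lemma adj_sym : symmetric (adj G).
Proof. by move=> x y; rewrite /adj /= setUC. Qed.

Lemma adj_neq x y : adj G x y -> x != y.
Proof.
move=> xy; have /forall_inP/(_ _ xy) := valP G.
by rewrite cards2; case: (x != y).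
Qed.

Lemma adj_irr x : adj G x x = false.
Proof. by apply/negP => /adj_neq; rewrite eqxx. Qed.

Lemma cycle_contains (x0 : T) (p : seq T) :
  uniq (x0 :: p) -> cycle (adj G) (x0 :: p) -> contains G (C_ (size p).+1).
Proof.
set q := x0 :: p => Up Cp.
apply/set0Pn; eexists; apply/imsetP.
exists [ffun i : 'I_(size q) => nth x0 q i]; last by reflexivity.
rewrite inE; apply/andP; split.
  apply/injectiveP => i j; rewrite !ffunE => /eqP.
  by rewrite nth_uniq ?ltn_ord // => /eqP/val_inj.
apply/subsetP => e /imsetP[_ /imsetP[i _ ->] ->].
rewrite imsetU !imset_set1 !ffunE /=.
move: Cp; rewrite /q /cycle => /(pathP x0) /(_ i).
rewrite size_rcons => /(_ (ltn_ord i)).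
have -> : nth x0 (x0 :: rcons p x0) i = nth x0 (x0 :: p) i.
  by rewrite -rcons_cons nth_rcons ltn_ord.
suff -> : nth x0 (rcons p x0) i = nth x0 (x0 :: p) (i.+1 %% (size p).+1) by [].
have := ltn_ord i; rewrite ltnS leq_eqVlt nth_rcons => /orP[/eqP->|lti].
  by rewrite modnn ltnn eqxx.
by rewrite lti modn_small.
Qed.

(** Strong induction on the length: at a repeated vertex the walk splits into two shorter closed
    walks, one of them odd. Without repetition it is a cycle, and irreflexivity excludes length
    1. *)
Lemma odd_closed_walk_contains (p : seq T) :
  cycle (adj G) p -> odd (size p) ->
  exists m, [/\ (3 <= m)%N, odd m & contains G (C_ m)].
Proof.
have [n] := ubnP (size p); elim: n p => // n IHn p ltpn Cp Op.
have [x _ | p0] := pickP (mem p); last first.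
  by case: p p0 {ltpn Cp} Op => // y p /(_ y); rewrite /= mem_head.
have [Up|] := boolP (uniq p).
  exists (size p); split=> //.
    case: p Cp Op {ltpn Up} => [|y [|z [|t p]]] //=.
    by rewrite adj_irr.
  by case: p Cp Op Up {ltpn} => // y p Cp _ Up; apply: cycle_contains Up Cp.
case/(uniqPn x) => i [j [ij jp eqij]].
have ip : (i < size p)%N by exact: ltn_trans jp.
(* Rotate the walk to start at the repeated vertex [y]; it then reads [y :: p1 ++ y :: p2 ++ p3],
   which is cut before the second [y]. *)
move: Cp; rewrite -(rot_cycle i).
move: (size_rot i p); rewrite /rot (drop_nth x ip) /=.
rewrite -[drop i.+1 p](cat_take_drop (j - i.+1)) drop_drop subnK //.
rewrite (drop_nth x jp) -eqij; set y := nth x p i.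
set p1 := take _ _; set p2 := drop _ _; set p3 := take _ _ => szp.
rewrite -catA /= rcons_cat cat_path /= => /and3P[Cp1 ly Cp2].
move: szp Op ltpn; rewrite !size_cat /= => <- Op ltpn.
have Cy1 : cycle (adj G) (y :: p1) by rewrite /= rcons_path Cp1.
have Cy2 : cycle (adj G) (y :: p2 ++ p3) by [].
have [Oq|Eq] := boolP (odd (size (y :: p1))).
  by apply: IHn Cy1 Oq; rewrite /=; lia.
by apply: IHn Cy2 _; move: Op Eq; rewrite /= size_cat; lia.
Qed.


(** * Two-colouring through the bipartite double cover, whose second coordinate tracks the parity of
    walks *)

Definition double_cover : rel (T * bool) :=
  [rel u v | adj G u.1 v.1 && (u.2 != v.2)].

Lemma double_cover_sym : connect_sym double_cover.
Proof. by apply: sym_connect_sym => u v; rewrite /double_cover /= adj_sym eq_sym. Qed.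

Lemma double_cover_path u p : path double_cover u p ->
  path (adj G) u.1 (map fst p) /\ (last u p).2 = u.2 (+) odd (size p).
Proof.
elim: p u => [|v p IHp] u /=; first by rewrite addbF.
case/andP=> /andP[-> uv] /IHp[-> ->]; split=> //.
by case: (u.2) (v.2) uv => [] [] //= _; case: odd.
Qed.

Lemma double_cover_lift x p b : path (adj G) x p ->
  connect double_cover (x, b) (last x p, b (+) odd (size p)).
Proof.
elim: p x b => [|y p IHp] x b /=; first by rewrite addbF.
case/andP=> xy /(IHp _ (~~ b)); rewrite addNb -addbN; apply: connect_trans.
by apply: connect1; rewrite /double_cover /= xy; case: b.
Qed.

(** A vertex is coloured by whether a walk of even length reaches it from the root of its component.
    If both ends of an edge are so reached, the two walks and the edge form an odd closed walk. If
    neither is, an odd walk to [x] extended by the edge is an even walk to [y]. *)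
Lemma bipartite_of_no_odd_cycle :
  (forall m, (3 <= m)%N -> odd m -> ~ contains G (C_ m)) ->
  exists c : T -> bool, forall x y, adj G x y -> c x != c y.
Proof.
move=> noodd; have csym : connect_sym (adj G) by exact/sym_connect_sym/adj_sym.
pose r x := fingraph.root (adj G) x.
exists (fun x => connect double_cover (r x, false) (x, false)) => x y xy.
have rxy : r x = r y by apply/eqP; rewrite root_connect // connect1.
have step b : connect double_cover (x, b) (y, ~~ b).
  by apply: connect1; rewrite /double_cover /= xy; case: b.
rewrite -rxy; case cx: connect; case cy: connect => //.
  have : connect double_cover (y, true) (y, false).
    apply: connect_trans cy; rewrite double_cover_sym.
    exact: connect_trans cx (step false).
  case/connectP => p /double_cover_path[/= yp oddp] lp.
  have {}oddp : odd (size p) by move: oddp; rewrite -lp /=; case: odd.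
  have ly : last y (map fst p) = y.
    by have /(congr1 fst) := lp; rewrite -(last_map fst) /= => <-.
  (* [cycle] lists a closed walk without repeating its base point: the vertices visited after the
     start already end at [y]. *)
  case: p yp lp oddp ly => // z p; rewrite [map _ _]/= => yp _ oddp ly.
  have Cp : cycle (adj G) (z.1 :: map fst p).
    by move: yp; rewrite /= rcons_path; move: ly => /= -> /andP[-> ->].
  have [|m [? ? ?]] := odd_closed_walk_contains Cp; first by rewrite /= size_map.
  by case: (noodd m).
have /connectP[p rp ex] : connect (adj G) (r x) x.
  by rewrite csym; apply: connect_root.
have := double_cover_lift false rp; rewrite -ex; case: odd; last by rewrite cx.
by move=> /connect_trans/(_ (step true)); rewrite cy.
Qed.

(** Distinct common neighbours [z] and [t] would close the 4-cycle [x], [z], [y], [t]. *)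
Lemma common_neighbour_unique x y z t : ~ contains G (C_ 4) -> x != y ->
  adj G x z -> adj G z y -> adj G x t -> adj G t y -> z = t.
Proof.
move=> noC4 xy xz zy xt ty; apply/eqP/negPn/negP => zt; apply: noC4.
apply: (@cycle_contains x [:: z; y; t]).
  have [xz' zy' xt' ty'] := And4 (adj_neq xz) (adj_neq zy) (adj_neq xt) (adj_neq ty).
  by rewrite /= !inE !negb_or xz' xy xt' zy' zt eq_sym ty'.
by rewrite /= xz zy (adj_sym y) ty (adj_sym t) xt.
Qed.

End Adjacency.

(** * Dihedral symmetries of the cycle, its vertices being the integers modulo its length *)

Definition dihedral n (j : 'I_n.+2) (s : bool) (i : 'I_n.+2) : 'I_n.+2 :=
  if s then j - i else j + i.

Lemma dihedral_inj n (j : 'I_n.+2) s : injective (dihedral j s).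
Proof. by case: s => x y /addrI // /oppr_inj. Qed.

Lemma ordS_add1 n (i : 'I_n.+2) : ordS i = i + 1.
Proof. by apply: val_inj; rewrite /= modnDmr addn1. Qed.

(** The value at 0 determines [j]; the value at 1 then determines [s], since [1 = -1] fails modulo
    [n.+3]. *)
Lemma dihedral_faithful n (j j' : 'I_n.+3) s s' :
  dihedral j s =1 dihedral j' s' -> j = j' /\ s = s'.
Proof.
move=> eqd; have jj' : j = j'.
  by have := eqd 0; rewrite /dihedral; case: s s' {eqd} => [] []; rewrite ?subr0 ?addr0.
split=> //; have := eqd 1; rewrite -jj' /dihedral.
case: s s' {eqd} => [] [] // /addrI; first move/esym.
  by move/eqP; rewrite -addr_eq0 => /eqP/(congr1 val); rewrite /= modn_small.
by move/eqP; rewrite -addr_eq0 => /eqP/(congr1 val); rewrite /= modn_small.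
Qed.

(** An injective map preserves the number of edges, so inclusion is enough. *)
Lemma dihedral_cycle_edges n (j : 'I_n.+2) s :
  [set dihedral j s @: (e : {set 'I_n.+2}) | e in cycle_edges n.+2]
    = cycle_edges n.+2.
Proof.
apply/eqP; rewrite eqEcard (card_imset _ (imset_inj (@dihedral_inj n j s))).
rewrite leqnn andbT.
apply/subsetP => _ /imsetP[_ /imsetP[i _ ->] ->].
rewrite imsetU !imset_set1 ordS_add1 /dihedral.
have nS (x : 'I_n.+2) : x != ordS x.
  rewrite ordS_add1 -subr_eq0 opprD addrA subrr add0r oppr_eq0.
  exact: oner_neq0.
case: s; last by apply/imsetP; exists (j + i); rewrite ?inE // ordS_add1 addrA.
apply/imsetP; exists (j - (i + 1)); first by rewrite inE.
by rewrite ordS_add1 opprD addrA subrK setUC.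
Qed.

(** * Counting labelled cycles *)

Section Labellings.
Variables (T : finType) (G : sgraph T) (n : nat).
Local Notation m := n.+3.

Definition labellings : {set {ffun 'I_m -> T}} :=
  [set f : {ffun 'I_m -> T} | injectiveb f &&
    ([set f @: (e : {set 'I_m}) | e in cycle_edges m] \subset edges G)].

Definition copy_of (f : {ffun 'I_m -> T}) : {set T} * {set {set T}} :=
  (f @: setT, [set f @: (e : {set 'I_m}) | e in cycle_edges m]).

Definition relabel (f : {ffun 'I_m -> T}) j s : {ffun 'I_m -> T} :=
  [ffun i => f (dihedral j s i)].

Lemma copies_cycleE : copies (C_ m) G = copy_of @: labellings.
Proof. by apply/setP => c; apply/imsetP/imsetP => -[f Lf ->]; exists f. Qed.

Lemma copy_of_relabel f j s : copy_of (relabel f j s) = copy_of f.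
Proof.
have fE (e : {set 'I_m}) : relabel f j s @: e = f @: (dihedral j s @: e).
  by rewrite -imset_comp; apply: eq_imset => i; rewrite ffunE.
congr pair.
  rewrite fE; suff -> : dihedral j s @: setT = setT by [].
  apply/eqP; rewrite eqEcard subsetT /= card_imset //.
  exact: dihedral_inj.
rewrite -[in RHS](dihedral_cycle_edges j s) -[RHS]imset_comp.
by apply: eq_imset => e; rewrite fE.
Qed.

Lemma relabel_labelling f j s : f \in labellings -> relabel f j s \in labellings.
Proof.
rewrite !inE => /andP[/injectiveP injf sf]; apply/andP; split.
  by apply/injectiveP => x y; rewrite !ffunE => /injf/dihedral_inj.
by have [_ ->] := copy_of_relabel f j s.
Qed.

Lemma labelling_adj f i : f \in labellings -> adj G (f i) (f (i + 1)).
Proof.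
rewrite inE => /andP[/injectiveP injf /subsetP]; apply.
apply/imsetP; exists [set i; ordS i]; last first.
  by rewrite imsetU !imset_set1 ordS_add1.
apply/imsetP; exists i => //; rewrite inE ordS_add1 -subr_eq0 opprD addrA subrr.
by rewrite add0r oppr_eq0 oner_neq0.
Qed.

Section Coloured.
Variables (c : T -> bool) (a : bool).
Hypothesis c_proper : forall x y, adj G x y -> c x != c y.

Lemma labelling_colour f (i : 'I_m) : f \in labellings ->
  c (f i) = c (f 0) (+) odd i.
Proof.
move=> Lf; case: i => i; elim: i => [|i IHi] ltim.
  by rewrite addbF; congr (c (f _)); apply: val_inj.
have lti : (i < m)%N by apply: ltnW.
have := c_proper (labelling_adj (Ordinal lti) Lf).
have -> : Ordinal lti + 1 = Ordinal ltim.
  by apply: val_inj; rewrite /= modnDmr addn1 modn_small.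
rewrite IHi /=; case: (c (f 0)); case: odd; case: (c _) => //.
Qed.

(** Colours alternate along a labelling, so fixing the colour at 0 puts colour [a] at exactly the
    even positions. *)
Definition coloured_labellings := [set f in labellings | c (f 0) == a].

Lemma coloured_representative C : C \in copies (C_ m) G ->
  exists2 f, f \in coloured_labellings & copy_of f = C.
Proof.
rewrite copies_cycleE => /imsetP[f Lf ->].
have [fa|fa] := eqVneq (c (f 0)) a; first by exists f; rewrite // inE Lf fa /=.
(* Rotating by one puts [f 1], of the opposite colour, at position 0. *)
exists (relabel f 1 false); last exact: copy_of_relabel.
rewrite inE relabel_labelling //= ffunE /dihedral addr0 labelling_colour //=.
by rewrite addbT; case: (c _) a fa => [] [].
Qed.

(** Each fibre of [copy_of] over a copy has at least [2 * k] elements: a labelling in it can be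
    moved by [k] rotations, with or without a reflection. *)
Lemma coloured_labellings_lower k : m = (2 * k)%N ->
  (#|copies (C_ m) G| * m <= #|coloured_labellings|)%N.
Proof.
move=> mk; rewrite -[X in (_ <= X)%N]sum1_card.
rewrite [X in (_ <= X)%N](partition_big copy_of (mem (copies (C_ m) G))); last first.
  by move=> f; rewrite inE copies_cycleE => /andP[Lf _]; apply: imset_f.
rewrite -sum_nat_const; apply: leq_sum => C /coloured_representative[f Lf fC].
move: (Lf); rewrite inE => /andP[lf /eqP fa].
(* Only even shifts are used, as these keep colour [a] at position 0. *)
pose h (u : 'I_k * bool) := relabel f (inord u.1.*2) u.2.
have double_lt (i : 'I_k) : (i.*2 < m)%N by rewrite mk mul2n ltn_double.
have h_inj : injective h.
  move=> [i s] [i' s'] /ffunP eqh.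
  have [] := @dihedral_faithful n (inord i.*2) (inord i'.*2) s s'.
    move=> x; have := eqh x; rewrite !ffunE.
    by move: lf; rewrite inE => /andP[/injectiveP injf _] /injf.
  by move/(congr1 (@nat_of_ord _)); rewrite !inordK // => /double_inj/val_inj-> ->.
rewrite sum1_card.
have cardh : #|h @: setT| = m.
  by rewrite card_imset // cardsT card_prod card_ord card_bool mk mulnC.
rewrite -[X in (X <= _)%N]cardh.
apply/subset_leq_card/subsetP => _ /imsetP[[i s] _ ->].
rewrite unfold_in /= copy_of_relabel fC eqxx andbT inE relabel_labelling //=.
rewrite ffunE -fa.
have -> : dihedral (inord i.*2) s 0 = inord i.*2 :> 'I_m.
  by rewrite /dihedral subr0 addr0 if_same.
by rewrite (labelling_colour (inord i.*2)) // inordK // odd_double addbF.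
Qed.

(** Restriction to even positions is injective on these labellings, because a vertex at an odd
    position is the only common neighbour of the two beside it. The restrictions are injections of
    ['I_k] into one colour class. *)
Lemma coloured_labellings_upper k : m = (2 * k)%N -> ~ contains G (C_ 4) ->
  (#|coloured_labellings| <= #|[set x | c x == a]| ^_ k)%N.
Proof.
move=> mk noC4.
pose h (f : {ffun 'I_m -> T}) : {ffun 'I_k -> T} :=
  [ffun i : 'I_k => f (inord i.*2)].
have double_lt (i : 'I_k) : (i.*2 < m)%N by rewrite mk mul2n ltn_double.
(* As [m] is even, adding 1 flips parity even where it wraps around. *)
have odd_m : odd m = false by rewrite mk oddM.
have odd_add1 (x : 'I_m) : odd (x + 1)%R = ~~ odd x.
  by rewrite /= odd_mod // oddD addbT.
have h_inj : {in coloured_labellings &, injective h}.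
  move=> f g /setIdP[Lf _] /setIdP[Lg _] /ffunP fg.
  have even_eq (x : 'I_m) : ~~ odd x -> f x = g x.
    move=> xe; have x2 : (x./2 < k)%N by have := ltn_ord x; lia.
    have := fg (Ordinal x2); rewrite !ffunE /=.
    suff -> : inord x./2.*2 = x :> 'I_m by [].
    by rewrite -[RHS]inord_val; congr inord; have := odd_double_half x; lia.
  apply/ffunP => x; have [xo|] := boolP (odd x); last exact: even_eq.
  have eq1 : f (x - 1) = g (x - 1).
    by apply: even_eq; rewrite -odd_add1 subrK.
  have eq2 : f (x + 1) = g (x + 1) by apply: even_eq; rewrite odd_add1 xo.
  apply: (common_neighbour_unique (x := f (x - 1)) (y := f (x + 1)) noC4).
  (* The two neighbouring positions differ because 2 is nonzero modulo [m]. *)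
  - move: Lf; rewrite inE => /andP[/injectiveP injf _].
    rewrite (inj_eq injf) -subr_eq0 opprD addrACA subrr add0r -opprD oppr_eq0.
    by apply/eqP => /(congr1 val); rewrite /= modn_small.
  - by have := labelling_adj (x - 1) Lf; rewrite subrK.
  - exact: labelling_adj.
  - by have := labelling_adj (x - 1) Lg; rewrite subrK eq1.
  - by rewrite eq2; apply: labelling_adj.
rewrite -(card_in_imset h_inj) -[in X in (_ <= X)%N](card_ord k).
rewrite -card_inj_ffuns_on; apply/subset_leq_card/subsetP => _ /imsetP[f Lf ->].
case/setIdP: Lf => Lf /eqP fa; rewrite inE; apply/andP; split.
  apply/ffun_onP => i; rewrite ffunE inE labelling_colour // inordK //.
  by rewrite odd_double addbF fa.
apply/injectiveP => i j; rewrite !ffunE.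
move: Lf; rewrite inE => /andP[/injectiveP injf _] /injf.
by move/(congr1 (@nat_of_ord _)); rewrite !inordK // => /double_inj/val_inj.
Qed.

End Coloured.
End Labellings.

(** * From the colour classes to the bound in [v / 2] *)

Lemma card_even_cycle_copies v (G : sgraph 'I_v) k : (3 <= k)%N ->
  is_free C_odd_C4 G ->
  exists2 N, (2 * N <= v)%N & (#|copies (C_ (2 * k)) G| * (2 * k) <= N ^_ k)%N.
Proof.
move=> k3 Gfree.
have noC4 : ~ contains G (C_ 4) by apply: Gfree; right.
have [c c_proper] : exists c : 'I_v -> bool, forall x y, adj G x y -> c x != c y.
  apply: bipartite_of_no_odd_cycle => m m3 mo; apply: Gfree; left.
  by exists m; split.
have [n mk] : exists n, n.+3 = (2 * k)%N by exists (2 * k - 3)%N; lia.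
have bound a : (#|copies (C_ (2 * k)) G| * (2 * k) <= #|[set x | c x == a]| ^_ k)%N.
  rewrite -mk; apply: leq_trans (coloured_labellings_upper a c_proper mk noC4).
  exact: (coloured_labellings_lower a c_proper mk).
have := cardsC [set x | c x == true]; rewrite card_ord.
have -> : ~: [set x | c x == true] = [set x | c x == false].
  by apply/setP => x; rewrite !inE; case: (c x).
(* [bound] holds for both colours; [N] is the size of the smaller class. *)
move=> sumv; have [le|/ltnW le] := leqP #|[set x | c x == true]| #|[set x | c x == false]|.
  by exists #|[set x | c x == true]|; [lia | apply: bound].
by exists #|[set x | c x == false]|; [lia | apply: bound].
Qed.

(** The products compare factor by factor; [k <= N] keeps the factors [N - i] nonnegative and their
    subtraction untruncated. *)
Lemma ffact_le_falling (R : realFieldType) (N k : nat) (x : R) :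
  (k <= N)%N -> N%:R <= x -> (N ^_ k)%:R <= falling x k.
Proof.
move=> kN Nx; rewrite ffact_prod natr_prod; apply: ler_prod => i _.
rewrite ler0n natrB ?lerB //; have := ltn_ord i; lia.
Qed.

Theorem theorem5 (R : realFieldType) (k : nat) (hk : (3 <= k)%N)
    (v : nat) (hv : (0 < v)%N) :
  (ex v (C_ (2 * k)) C_odd_C4)%:R
    <= Num.max 0 ((2 * k)%:R^-1 * falling (v%:R / 2%:R : R) k).
Proof.
(* The maximum is bounded term by term; its default value 0 is covered by [Num.max 0]. *)
rewrite /ex; apply: (big_ind (fun x : nat => x%:R <= Num.max 0 _)).
- by rewrite le_max lexx.
- by move=> x y hx hy; rewrite /maxn; case: ifP.
move=> G /boolp.asboolP Gfree.
have [N Nv bound] := card_even_cycle_copies hk Gfree.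
(* If [N < k], then [N ^_ k] vanishes and there are no copies; the real falling factorial may be
   negative here, so the comparison is with 0. *)
rewrite le_max; have [ltNk|kN] := ltnP N k.
  by move: bound; rewrite ffact_small // leqn0 muln_eq0 => /orP[/eqP->|]; [rewrite lexx | lia].
apply/orP; right; rewrite mulrC ler_pdivlMr ?ltr0n; last by lia.
rewrite -natrM; apply: (@le_trans _ _ (N ^_ k)%:R); first by rewrite ler_nat.
apply: ffact_le_falling => //.
by rewrite ler_pdivlMr ?ltr0n // -natrM ler_nat mulnC.
Qed.
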